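(* Let $q\in\mathbb C$ with $\operatorname{Re} q>0$, let $r>0$ satisfy $r\operatorname{Re} q>r_0$, and let $G_r\in\mathcal J_r$. Then for all $w\in\mathbb D$, $$\left|\frac{wG_r'(w)}{G_r(w)}-\frac{1}{1-A^2(r\operatorname{Re} q)}\right|\le\frac{A(r\operatorname{Re} q)}{1-A^2(r\operatorname{Re} q)} .$$
   Context: $\mathbb D=\{z\in\mathbb C:|z|<1\}$. The function $A$ of a real variable is $$A(x)=\frac{6x(1+x)}{(1+x)^3-3(5x-1)},$$ and $r_0$ denotes the largest real root of the equation $A(x)=1$, namely $r_0=1+2\sqrt7\cos\left(\frac13\arctan\frac{3\sqrt{31}}{8}\right)\approx5.92434$. $A^2(x)$ means $(A(x))^2$. Fix $q\in\mathbb C$ with $\operatorname{Re} q>0$. Consider generators $f$ on $\mathbb D$ with $f(0)=0$ and $f'(0)=q$; these are exactly the functions $f(z)=zp(z)$ with $p:\mathbb D\to\mathbb C$ holomorphic, $\operatorname{Re} p(z)\ge0$ on $\mathbb D$ and $p(0)=q$. It is known that for every such $f$ and every $r>0$ there is a unique holomorphic map $G_r:\mathbb D\to\mathbb D$ satisfying $G_r(w)+rf(G_r(w))=w$ for all $w\in\mathbb D$; it is univalent with $G_r(0)=0$, is written $G_r=(\mathrm{Id}+rf)^{-1}$, and is called the nonlinear resolvent of $f$ with parameter $r$. For $r>0$, $\mathcal J_r$ denotes the set of all resolvents $G_r=(\mathrm{Id}+rf)^{-1}$ of all such $f$ (with the fixed $q$). The quotient $wG_r'(w)/G_r(w)$ is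 taken to be $1$ (its limit) at $w=0$. *)

(* Defs.v *)
From Stdlib Require Import Reals Lra.
From Coquelicot Require Import Coquelicot.

Open Scope R_scope.

Definition A (x : R) : R :=
  6 * x * (1 + x) / ((1 + x) ^ 3 - 3 * (5 * x - 1)).

Definition r0 : R :=
  1 + 2 * sqrt 7 * cos (1 / 3 * atan (3 * sqrt 31 / 8)).

Lemma r0_root_cubic : r0 ^ 3 - 3 * r0 ^ 2 - 18 * r0 + 4 = 0 /\ 7 < (r0 - 1) ^ 2 /\ 1 < r0.
Proof.
set (t := 3 * sqrt 31 / 8).
set (th := 1 / 3 * atan t).
set (c := cos th).
set (s := sqrt 7).
assert (Hr : r0 = 1 + 2 * s * c) by reflexivity.
assert (Hs : s * s = 7) by (apply sqrt_sqrt; lra).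
assert (Hs0 : 0 < s) by (apply sqrt_lt_R0; lra).
assert (H31 : sqrt 31 * sqrt 31 = 31) by (apply sqrt_sqrt; lra).
assert (Ht2 : t² = 279 / 64) by (unfold t, Rsqr; nra).
assert (Ht0 : 0 < t).
{ unfold t. assert (0 < sqrt 31) by (apply sqrt_lt_R0; lra). lra. }
assert (Hc3 : cos (3 * th) = 4 * c ^ 3 - 3 * c).
{ replace (3 * th) with (2 * th + th) by ring.
  rewrite cos_plus, cos_2a_cos, sin_2a. fold c.
  assert (Hp := sin2_cos2 th). unfold Rsqr in Hp. fold c in Hp.
  replace (2 * sin th * c * sin th) with (2 * c * (sin th * sin th)) by ring.
  replace (sin th * sin th) with (1 - c * c) by lra. ring. }
assert (Hat : cos (atan t) = 8 / (7 * s)).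
{ rewrite cos_atan, Ht2.
  replace (1 + 279 / 64) with ((7 * s / 8) * (7 * s / 8)) by nra.
  rewrite sqrt_square by lra. field. lra. }
replace (3 * th) with (atan t) in Hc3 by (unfold th; field).
rewrite Hat in Hc3.
assert (Hk : s * (4 * c ^ 3 - 3 * c) = 8 / 7).
{ rewrite <- Hc3. field. lra. }
assert (Hc : 1 / 2 < c).
{ rewrite <- cos_PI3. unfold c. pose proof PI_RGT_0.
  assert (Ha := atan_bound t).
  assert (0 < atan t) by (rewrite <- atan_0; apply atan_increasing; lra).
  apply cos_decreasing_1; unfold th; lra. }
rewrite Hr. split; [|split].
- replace ((1 + 2 * s * c) ^ 3 - 3 * (1 + 2 * s * c) ^ 2 - 18 * (1 + 2 * s * c) + 4)
    with (8 * (s * s) * (s * c ^ 3) - 42 * (s * c) - 16) by ring.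
  rewrite Hs. lra.
- replace ((1 + 2 * s * c - 1) ^ 2) with (4 * (s * s) * (c * c)) by ring.
  rewrite Hs. nra.
- nra.
Qed.

Lemma r0_largest_root : A r0 = 1 /\ forall x : R, A x = 1 -> x <= r0.
Proof.
destruct r0_root_cubic as [Hc [H7 H1]].
split.
- unfold A.
  assert (E : (1 + r0) ^ 3 - 3 * (5 * r0 - 1) = 6 * r0 * (1 + r0)) by nra.
  rewrite E. field. nra.
- intros x Hx. destruct (Rle_or_lt x r0) as [H | H]; [exact H | exfalso].
  unfold A in Hx.
  set (d := (1 + x) ^ 3 - 3 * (5 * x - 1)) in Hx.
  destruct (Req_dec d 0) as [Hd | Hd].
  + rewrite Hd in Hx. unfold Rdiv in Hx. rewrite Rinv_0 in Hx. lra.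
  + assert (E : 6 * x * (1 + x) = d).
    { replace (6 * x * (1 + x)) with (6 * x * (1 + x) / d * d) by (field; exact Hd).
      rewrite Hx. ring. }
    unfold d in E.
    assert (P : (x - r0) * ((x - 1) ^ 2 + (x - 1) * (r0 - 1) + (r0 - 1) ^ 2 - 21) = 0) by nra.
    assert (Q : 0 < (x - 1) ^ 2 + (x - 1) * (r0 - 1) + (r0 - 1) ^ 2 - 21) by nra.
    apply Rmult_integral in P. lra.
Qed.

Definition in_disk (z : C) : Prop := Cmod z < 1.

(* Functions on the unit disk are represented by total functions on [C];
   only their values on the disk matter. *)
Definition holomorphic_on_disk (f : C -> C) : Prop :=
  forall z : C, in_disk z -> @ex_derive C_AbsRing C_NormedModule f z.

(* Generators f on the disk with f(0) = 0 and f'(0) = q. *)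
Definition generator (q : C) (f : C -> C) : Prop :=
  exists p : C -> C,
    holomorphic_on_disk p /\
    (forall z : C, in_disk z -> 0 <= Re (p z)) /\
    p (RtoC 0) = q /\
    (forall z : C, in_disk z -> f z = (z * p z)%C).

(* G = (Id + r f)^{-1} *)
Definition resolvent (r : R) (f G : C -> C) : Prop :=
  holomorphic_on_disk G /\
  (forall w : C, in_disk w -> in_disk (G w)) /\
  (forall w : C, in_disk w -> (G w + RtoC r * f (G w))%C = w).

(* The class J_r, for the fixed value q = f'(0). *)
Definition resolvents (q : C) (r : R) (G : C -> C) : Prop :=
  exists f : C -> C, generator q f /\ resolvent r f G.

(* w G'(w) / G(w), extended by its limit 1 at the removable singularity 0. *)
Definition log_derivative (G : C -> C) (w : C) : C :=
  if Ceq_dec w (RtoC 0) then RtoC 1 else (w * C_derive G w / G w)%C.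

(* Main.v *)
(** Put [z = G w] and [D = 1 + r p z], so that [w = z D]. Differentiating
    [G v (1 + r p (G v)) = v] gives [w G' w / G w = D / (D + U)] with
    [U = r z p' z], and the claimed disk is the image of [|U / D| <= A] under
    [u |-> 1 / (1 + u)]. Write [a = r Re q]. By Schwarz-Pick for the half-plane,
    [|p' z| (1 - |z|^2) <= 2 Re (p z)], whence [|U / D| <= 2 |z| / (1 - |z|^2)].
    Harnack's inequality for [Re p] together with [|z| |1 + r p z| = |w| < 1]
    forces [|z| < 1 / (a - 1)], and then
    [2 |z| / (1 - |z|^2) <= 2 (a - 1) / (a (a - 2)) <= A a].

    Schwarz's lemma only needs the maximum principle at the centre of a disk;
    it follows from Goursat's theorem on rectangles in the coordinate [log z]. *)

Require Import Defs.
From Stdlib Require Import Reals Lra ClassicalEpsilon.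
From Coquelicot Require Import Coquelicot.

Open Scope R_scope.

(** * Complex derivatives *)

(* [C_AbsRing] as a module over itself, for which Coquelicot has the product
   and chain rules, unlike for [C_NormedModule], whose balls are squares. *)
Notation is_Cderive f z l :=
  (@is_derive C_AbsRing (AbsRing_NormedModule C_AbsRing) (f : C -> C) (z : C) (l : C)).

Lemma is_Cderive_iff (f : C -> C) (z l : C) :
  is_Cderive f z l <->
  forall e : R, 0 < e -> exists d : R, 0 < d /\
    forall y : C, Cmod (y - z) < d ->
      Cmod (f y - f z - l * (y - z))%C <= e * Cmod (y - z).
Proof.
split.
- intros [_ H] e He.
  destruct (H z (fun P HP => HP) (mkposreal e He)) as [d Hd].
  exists d. split; [apply cond_pos|]. intros y Hy.
  generalize (Hd y Hy).
  replace (Cmod (f y - f z - l * (y - z))%C)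
    with (Cmod (f y - f z - (y - z) * l)%C) by (f_equal; ring).
  (* The module norm and subtraction are convertible to [Cmod] and complex subtraction. *)
  exact (fun h => h).
- intros H. split; [apply is_linear_scal_l|].
  intros x Hx e.
  apply (@is_filter_lim_locally_unique C_AbsRing (AbsRing_NormedModule C_AbsRing)) in Hx.
  subst x.
  destruct (H e (cond_pos e)) as [d [Hd Hy]].
  exists (mkposreal d Hd). intros y Hyz.
  generalize (Hy y Hyz).
  replace (Cmod (f y - f z - l * (y - z))%C)
    with (Cmod (f y - f z - (y - z) * l)%C) by (f_equal; ring).
  exact (fun h => h).
Qed.

(** The two notions differ only in the structure on the codomain, and the remainder estimate uses
    just its norm, which is [Cmod] in both. *)
Lemma is_Cderive_C_derive (f : C -> C) (z : C) :
  @ex_derive C_AbsRing C_NormedModule f z -> is_Cderive f z (C_derive f z).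
Proof.
intros H. apply (C_derive_correct f z z) in H.
destruct H as [_ H]. split; [apply is_linear_scal_l|].
intros x Hx e.
apply (@is_filter_lim_locally_unique C_AbsRing (AbsRing_NormedModule C_AbsRing)) in Hx.
subst x.
exact (H z (fun P HP => HP) e).
Qed.

Lemma is_Cderive_ext_near (f g : C -> C) (z l : C) (d : R) :
  0 < d -> (forall y, Cmod (y - z) < d -> f y = g y) ->
  is_Cderive f z l -> is_Cderive g z l.
Proof.
intros Hd H. apply is_derive_ext_loc. exists (mkposreal d Hd). exact H.
Qed.

Lemma is_Cderive_eq (f : C -> C) (z l m : C) :
  is_Cderive f z l -> l = m -> is_Cderive f z m.
Proof. intros H <-. exact H. Qed.

Lemma is_Cderive_const (a z : C) : is_Cderive (fun _ => a) z 0%C.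
Proof. exact (@is_derive_const C_AbsRing (AbsRing_NormedModule C_AbsRing) a z). Qed.

Lemma is_Cderive_id (z : C) : is_Cderive (fun y => y) z 1%C.
Proof. exact (@is_derive_id C_AbsRing z). Qed.

Lemma is_Cderive_plus (f g : C -> C) (z l m : C) :
  is_Cderive f z l -> is_Cderive g z m ->
  is_Cderive (fun y => f y + g y)%C z (l + m)%C.
Proof. exact (@is_derive_plus C_AbsRing (AbsRing_NormedModule C_AbsRing) f g z l m). Qed.

Lemma is_Cderive_mult (f g : C -> C) (z l m : C) :
  is_Cderive f z l -> is_Cderive g z m ->
  is_Cderive (fun y => f y * g y)%C z (l * g z + f z * m)%C.
Proof.
intros Hf Hg.
exact (@is_derive_mult C_AbsRing f g z l m Hf Hg Cmult_comm).
Qed.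

Lemma is_Cderive_comp (f g : C -> C) (z l m : C) :
  is_Cderive f (g z) l -> is_Cderive g z m ->
  is_Cderive (fun y => f (g y)) z (m * l)%C.
Proof.
exact (@is_derive_comp C_AbsRing (AbsRing_NormedModule C_AbsRing) f g z l m).
Qed.

Lemma is_Cderive_unique (f : C -> C) (z l m : C) :
  is_Cderive f z l -> is_Cderive f z m -> l = m.
Proof.
rewrite !is_Cderive_iff. intros Hl Hm.
destruct (Ceq_dec l m) as [E|E]; [exact E|exfalso].
assert (Hp : 0 < Cmod (l - m)%C).
{ apply Cmod_gt_0. intros H. apply E.
  replace l with (l - m + m)%C by ring. rewrite H. ring. }
(* Two expansions with tolerance |l - m| / 4, at the same real increment h, give |l - m| h <= |l -
   m| h / 2. *)
destruct (Hl (Cmod (l - m)%C / 4)) as [d1 [Hd1 H1]]; [lra|].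
destruct (Hm (Cmod (l - m)%C / 4)) as [d2 [Hd2 H2]]; [lra|].
assert (Hmin : 0 < Rmin d1 d2) by (apply Rmin_pos; lra).
set (h := Rmin d1 d2 / 2) in *.
assert (Hh : 0 < h < Rmin d1 d2) by (unfold h; lra).
assert (Hyz : (z + RtoC h - z)%C = RtoC h) by ring.
specialize (H1 (z + RtoC h)%C). specialize (H2 (z + RtoC h)%C).
rewrite Hyz, Cmod_R, Rabs_pos_eq in H1, H2 by lra.
pose proof (Rmin_l d1 d2). pose proof (Rmin_r d1 d2).
specialize (H1 ltac:(lra)). specialize (H2 ltac:(lra)).
assert (T := Cmod_triangle (f (z + RtoC h)%C - f z - m * RtoC h)
               (- (f (z + RtoC h)%C - f z - l * RtoC h))).
rewrite Cmod_opp in T.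
replace (f (z + RtoC h)%C - f z - m * RtoC h + - (f (z + RtoC h)%C - f z - l * RtoC h))%C
  with ((l - m) * RtoC h)%C in T by ring.
rewrite Cmod_mult, Cmod_R, Rabs_pos_eq in T by lra.
nra.
Qed.

Lemma is_Cderive_continuity (f : C -> C) (z l : C) :
  is_Cderive f z l -> forall e, 0 < e ->
  exists d, 0 < d /\ forall y, Cmod (y - z) < d -> Cmod (f y - f z)%C < e.
Proof.
rewrite is_Cderive_iff. intros H e He.
destruct (H 1 Rlt_0_1) as [d [Hd Hy]].
pose proof (Cmod_ge_0 l).
exists (Rmin d (e / (Cmod l + 2))).
assert (0 < e / (Cmod l + 2)) by (apply Rdiv_lt_0_compat; lra).
split; [apply Rmin_pos; lra|].
intros y Hyd.
pose proof (Rmin_l d (e / (Cmod l + 2))). pose proof (Rmin_r d (e / (Cmod l + 2))).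
specialize (Hy y ltac:(lra)).
replace (f y - f z)%C with ((f y - f z - l * (y - z)) + l * (y - z))%C by ring.
eapply Rle_lt_trans; [apply Cmod_triangle|].
rewrite Cmod_mult.
assert (Cmod (y - z) * (Cmod l + 2) < e).
{ apply (Rmult_lt_compat_r (Cmod l + 2)) in Hyd; [|lra].
  eapply Rlt_le_trans; [exact Hyd|].
  apply Rle_trans with (e / (Cmod l + 2) * (Cmod l + 2)).
  - apply Rmult_le_compat_r; lra.
  - right. field. lra. }
pose proof (Cmod_ge_0 (y - z)).
nra.
Qed.

Lemma Cmod_minus_sym (a b : C) : Cmod (a - b)%C = Cmod (b - a)%C.
Proof. rewrite <- Cmod_opp. f_equal. ring. Qed.

Lemma Cmod_triangle_rev (a b : C) : Cmod a - Cmod (b - a)%C <= Cmod b.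
Proof.
pose proof (Cmod_triangle b (a - b)) as T.
replace (b + (a - b))%C with a in T by ring.
rewrite (Cmod_minus_sym b a). lra.
Qed.

Lemma is_Cderive_Cinv (z : C) :
  z <> 0%C -> is_Cderive Cinv z (- / (z * z))%C.
Proof.
intros Hz. apply is_Cderive_iff. intros e He.
assert (Hm := proj1 (Cmod_gt_0 z) Hz). set (m := Cmod z) in *.
assert (Hm3 : 0 < m * m * m) by (repeat apply Rmult_lt_0_compat; lra).
(* The first bound keeps |y| at least m / 2; the second then makes the remainder (y - z)^2 / (y z^2)
   at most e |y - z|. *)
exists (Rmin (m / 2) (e * (m * m * m) / 2)).
split; [apply Rmin_pos; nra|].
intros y Hy.
pose proof (Rmin_l (m / 2) (e * (m * m * m) / 2)).
pose proof (Rmin_r (m / 2) (e * (m * m * m) / 2)).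
pose proof (Cmod_triangle_rev z y) as T. fold m in T.
assert (Hy0 : y <> 0%C) by (apply Cmod_gt_0; lra).
replace (/ y - / z - - / (z * z) * (y - z))%C
  with ((y - z) * (y - z) * / (y * (z * z)))%C by (field; split; assumption).
rewrite !Cmod_mult, Cmod_inv by (repeat apply Cmult_neq_0; assumption).
rewrite !Cmod_mult. fold m.
set (h := Cmod (y - z)) in *.
assert (Hh : 0 <= h) by apply Cmod_ge_0.
assert (Hq : 0 < Cmod y * (m * m)) by (repeat apply Rmult_lt_0_compat; lra).
apply Rle_trans with (h * (h * / (Cmod y * (m * m)))); [right; ring|].
rewrite (Rmult_comm e). apply Rmult_le_compat_l; [exact Hh|].
apply (Rmult_le_reg_r (Cmod y * (m * m))); [exact Hq|].
rewrite Rmult_assoc, Rinv_l by lra.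
assert (m * m * m / 2 <= Cmod y * (m * m)) by nra.
nra.
Qed.

Lemma is_Cderive_inv (f : C -> C) (z l : C) :
  f z <> 0%C -> is_Cderive f z l ->
  is_Cderive (fun y => / f y)%C z (l * (- / (f z * f z)))%C.
Proof.
intros Hz Hf. apply (is_Cderive_comp Cinv f); [|exact Hf].
apply is_Cderive_Cinv, Hz.
Qed.

(** * Goursat's theorem on rectangles *)

Lemma im_le_Cmod (c : C) : Rabs (Im c) <= Cmod c.
Proof. eapply Rle_trans; [apply Rmax_r|apply (Rmax_Cmod c)]. Qed.

Lemma Cmod_le_Rabs (x y : R) : Cmod (x, y) <= Rabs x + Rabs y.
Proof.
replace (x, y) with (RtoC x + Ci * RtoC y)%C
  by (unfold RtoC, Ci, Cplus, Cmult; simpl; f_equal; ring).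
eapply Rle_trans; [apply Cmod_triangle|].
rewrite Cmod_mult, !Cmod_R.
replace (Cmod Ci) with 1; [lra|].
unfold Cmod, Ci. simpl. replace (0 * (0 * 1) + 1 * (1 * 1)) with 1 by ring.
now rewrite sqrt_1.
Qed.

Lemma Cminus_pair (a b c d : R) : ((a, b) - (c, d))%C = (a - c, b - d).
Proof. reflexivity. Qed.

(** Used with [phi] equal to [Re] or [Im] and [g] a horizontal or vertical line, to integrate over
    the sides of rectangles. *)
Lemma continuous_along (h : C -> C) (phi : C -> R) (g : R -> C) (t : R) (l : C) :
  (forall a b, Rabs (phi a - phi b) <= Cmod (a - b)%C) ->
  (forall s, Cmod (g s - g t)%C <= Rabs (s - t)) ->
  is_Cderive h (g t) l ->
  continuous (fun s => phi (h (g s))) t.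
Proof.
intros Hphi Hg Hh. apply filterlim_locally. intros e.
destruct (is_Cderive_continuity _ _ _ Hh e (cond_pos e)) as [d [Hd H]].
exists (mkposreal d Hd). intros s Hs.
eapply Rle_lt_trans; [apply Hphi|].
apply H. eapply Rle_lt_trans; [apply Hg|exact Hs].
Qed.

Definition differentiable_on_rect (h : C -> C) (x1 x2 y1 y2 : R) : Prop :=
  forall x y, x1 <= x <= x2 -> y1 <= y <= y2 -> exists l, is_Cderive h (x, y) l.

(* The imaginary part of the contour integral of h along the boundary of
   [x1, x2] * [y1, y2]. *)
Definition rect_integral (h : C -> C) (x1 x2 y1 y2 : R) : R :=
  RInt (fun x => Im (h (x, y1)) - Im (h (x, y2))) x1 x2 +
  RInt (fun y => Re (h (x2, y)) - Re (h (x1, y))) y1 y2.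

Lemma Re_lip (a b : C) : Rabs (Re a - Re b) <= Cmod (a - b)%C.
Proof. exact (re_le_Cmod (a - b)%C). Qed.

Lemma Im_lip (a b : C) : Rabs (Im a - Im b) <= Cmod (a - b)%C.
Proof. exact (im_le_Cmod (a - b)%C). Qed.

Lemma ex_RInt_horizontal (h : C -> C) (x1 x2 y1 y2 y : R) :
  x1 <= x2 -> y1 <= y <= y2 -> differentiable_on_rect h x1 x2 y1 y2 ->
  ex_RInt (fun x => Im (h (x, y))) x1 x2.
Proof.
intros Hx Hy H. apply (@ex_RInt_continuous R_CompleteNormedModule).
intros x. rewrite Rmin_left, Rmax_right by exact Hx. intros Hxx.
destruct (H x y Hxx Hy) as [l Hl].
apply (continuous_along h Im (fun x => (x, y)) x l Im_lip); [|exact Hl].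
intros s. rewrite Cminus_pair, Rminus_diag.
eapply Rle_trans; [apply Cmod_le_Rabs|]. rewrite Rabs_R0. lra.
Qed.

Lemma ex_RInt_vertical (h : C -> C) (x1 x2 y1 y2 x : R) :
  y1 <= y2 -> x1 <= x <= x2 -> differentiable_on_rect h x1 x2 y1 y2 ->
  ex_RInt (fun y => Re (h (x, y))) y1 y2.
Proof.
intros Hy Hx H. apply (@ex_RInt_continuous R_CompleteNormedModule).
intros y. rewrite Rmin_left, Rmax_right by exact Hy. intros Hyy.
destruct (H x y Hx Hyy) as [l Hl].
apply (continuous_along h Re (fun y => (x, y)) y l Re_lip); [|exact Hl].
intros s. rewrite Cminus_pair, Rminus_diag.
eapply Rle_trans; [apply Cmod_le_Rabs|]. rewrite Rabs_R0. lra.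
Qed.

Lemma differentiable_on_subrect (h : C -> C) (x1 x2 y1 y2 x1' x2' y1' y2' : R) :
  x1 <= x1' -> x2' <= x2 -> y1 <= y1' -> y2' <= y2 ->
  differentiable_on_rect h x1 x2 y1 y2 -> differentiable_on_rect h x1' x2' y1' y2'.
Proof. intros ? ? ? ? H x y Hx Hy. apply H; lra. Qed.

Lemma rect_integral_eq (h : C -> C) (x1 x2 y1 y2 : R) :
  x1 <= x2 -> y1 <= y2 -> differentiable_on_rect h x1 x2 y1 y2 ->
  rect_integral h x1 x2 y1 y2 =
  RInt (fun x => Im (h (x, y1))) x1 x2 - RInt (fun x => Im (h (x, y2))) x1 x2 +
  (RInt (fun y => Re (h (x2, y))) y1 y2 - RInt (fun y => Re (h (x1, y))) y1 y2).
Proof.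
intros Hx Hy H. unfold rect_integral. f_equal.
- apply (@RInt_minus R_CompleteNormedModule);
    apply (ex_RInt_horizontal h x1 x2 y1 y2); (exact H || lra).
- apply (@RInt_minus R_CompleteNormedModule);
    apply (ex_RInt_vertical h x1 x2 y1 y2); (exact H || lra).
Qed.

Lemma rect_integral_split_x (h : C -> C) (x1 m x2 y1 y2 : R) :
  x1 <= m <= x2 -> y1 <= y2 -> differentiable_on_rect h x1 x2 y1 y2 ->
  rect_integral h x1 x2 y1 y2 = rect_integral h x1 m y1 y2 + rect_integral h m x2 y1 y2.
Proof.
intros Hx Hy H.
assert (H1 : differentiable_on_rect h x1 m y1 y2)
  by (revert H; apply differentiable_on_subrect; lra).
assert (H2 : differentiable_on_rect h m x2 y1 y2)
  by (revert H; apply differentiable_on_subrect; lra).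
rewrite !rect_integral_eq by (exact H || exact H1 || exact H2 || lra).
assert (E : forall y, y1 <= y <= y2 ->
  RInt (fun x => Im (h (x, y))) x1 m + RInt (fun x => Im (h (x, y))) m x2 =
  RInt (fun x => Im (h (x, y))) x1 x2).
{ intros y Hyy. apply (@RInt_Chasles R_CompleteNormedModule).
  - apply (ex_RInt_horizontal h x1 m y1 y2); (exact H1 || lra).
  - apply (ex_RInt_horizontal h m x2 y1 y2); (exact H2 || lra). }
rewrite <- (E y1), <- (E y2) by lra. ring.
Qed.

Lemma rect_integral_split_y (h : C -> C) (x1 x2 y1 m y2 : R) :
  x1 <= x2 -> y1 <= m <= y2 -> differentiable_on_rect h x1 x2 y1 y2 ->
  rect_integral h x1 x2 y1 y2 = rect_integral h x1 x2 y1 m + rect_integral h x1 x2 m y2.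
Proof.
intros Hx Hy H.
assert (H1 : differentiable_on_rect h x1 x2 y1 m)
  by (revert H; apply differentiable_on_subrect; lra).
assert (H2 : differentiable_on_rect h x1 x2 m y2)
  by (revert H; apply differentiable_on_subrect; lra).
rewrite !rect_integral_eq by (exact H || exact H1 || exact H2 || lra).
assert (E : forall x, x1 <= x <= x2 ->
  RInt (fun y => Re (h (x, y))) y1 m + RInt (fun y => Re (h (x, y))) m y2 =
  RInt (fun y => Re (h (x, y))) y1 y2).
{ intros x Hxx. apply (@RInt_Chasles R_CompleteNormedModule).
  - apply (ex_RInt_vertical h x1 x2 y1 m); (exact H1 || lra).
  - apply (ex_RInt_vertical h x1 x2 m y2); (exact H2 || lra). }
rewrite <- (E x1), <- (E x2) by lra. ring.
Qed.

Lemma RInt_near_const (f : R -> R) (a b c e : R) :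
  a <= b -> ex_RInt f a b ->
  (forall t, a <= t <= b -> Rabs (f t - c) <= e) ->
  Rabs (RInt f a b - c * (b - a)) <= (b - a) * e.
Proof.
intros Hab Hf H.
replace (RInt f a b - c * (b - a)) with (RInt (fun t => f t - c) a b).
- apply abs_RInt_le_const; [exact Hab| |exact H].
  apply (@ex_RInt_minus R_NormedModule f (fun _ => c)); [exact Hf|apply ex_RInt_const].
- etransitivity.
  + apply (@RInt_minus R_CompleteNormedModule f (fun _ => c));
      [exact Hf|apply ex_RInt_const].
  + rewrite RInt_const. change (RInt f a b - (b - a) * c = RInt f a b - c * (b - a)). ring.
Qed.

(* The contour integral of an affine function vanishes, so only the
   remainder of the first order expansion contributes. *)
Lemma rect_integral_small (h : C -> C) (z0 l : C) (d e x1 x2 y1 y2 : R) :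
  0 <= e ->
  (forall z, Cmod (z - z0) < d ->
    Cmod (h z - h z0 - l * (z - z0))%C <= e * Cmod (z - z0)) ->
  x1 <= Re z0 <= x2 -> y1 <= Im z0 <= y2 ->
  (x2 - x1) + (y2 - y1) < d ->
  differentiable_on_rect h x1 x2 y1 y2 ->
  Rabs (rect_integral h x1 x2 y1 y2) <= 2 * e * ((x2 - x1) + (y2 - y1)) ^ 2.
Proof.
intros He Hloc Hx Hy Hd H.
set (s := (x2 - x1) + (y2 - y1)) in *.
assert (Hnear : forall x y, x1 <= x <= x2 -> y1 <= y <= y2 -> Cmod ((x, y) - z0) <= s).
{ intros x y Hxx Hyy. destruct z0 as [x0 y0]. simpl in Hx, Hy.
  rewrite Cminus_pair. eapply Rle_trans; [apply Cmod_le_Rabs|].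
  unfold s. apply Rplus_le_compat; apply Rabs_le; lra. }
assert (Hdiff : forall x y x' y', x1 <= x <= x2 -> y1 <= y <= y2 ->
  x1 <= x' <= x2 -> y1 <= y' <= y2 ->
  Cmod (h (x, y) - h (x', y') - l * ((x, y) - (x', y')))%C <= 2 * e * s).
{ intros x y x' y' A1 A2 A3 A4.
  pose proof (Hnear x y A1 A2) as N1. pose proof (Hnear x' y' A3 A4) as N2.
  pose proof (Hloc (x, y) ltac:(lra)) as L1. pose proof (Hloc (x', y') ltac:(lra)) as L2.
  replace (h (x, y) - h (x', y') - l * ((x, y) - (x', y')))%C
    with ((h (x, y) - h z0 - l * ((x, y) - z0)) +
          - (h (x', y') - h z0 - l * ((x', y') - z0)))%C by ring.
  eapply Rle_trans; [apply Cmod_triangle|]. rewrite Cmod_opp. nra. }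
unfold rect_integral.
(* Opposite sides differ by [l] times a constant displacement, up to 2 e s. The main terms of [I1]
   and [I2] are opposite, so only the errors survive in the sum. *)
assert (I1 : Rabs (RInt (fun x => Im (h (x, y1)) - Im (h (x, y2))) x1 x2
                   - (Re l * (y1 - y2)) * (x2 - x1)) <= (x2 - x1) * (2 * e * s)).
{ apply RInt_near_const; [lra| |].
  - apply (@ex_RInt_minus R_NormedModule);
      apply (ex_RInt_horizontal h x1 x2 y1 y2); (exact H || lra).
  - intros t Ht.
    eapply Rle_trans; [|apply (Hdiff t y1 t y2); lra].
    eapply Rle_trans; [|apply im_le_Cmod].
    right. f_equal. rewrite Cminus_pair.
    unfold Cminus, Cplus, Copp, Cmult, Im, Re. simpl. ring. }
assert (I2 : Rabs (RInt (fun y => Re (h (x2, y)) - Re (h (x1, y))) y1 y2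
                   - (Re l * (x2 - x1)) * (y2 - y1)) <= (y2 - y1) * (2 * e * s)).
{ apply RInt_near_const; [lra| |].
  - apply (@ex_RInt_minus R_NormedModule);
      apply (ex_RInt_vertical h x1 x2 y1 y2); (exact H || lra).
  - intros t Ht.
    eapply Rle_trans; [|apply (Hdiff x2 t x1 t); lra].
    eapply Rle_trans; [|apply re_le_Cmod].
    right. f_equal. rewrite Cminus_pair.
    unfold Cminus, Cplus, Copp, Cmult, Im, Re. simpl. ring. }
apply Rabs_le_between in I1. apply Rabs_le_between in I2. apply Rabs_le.
unfold s in *. nra.
Qed.

(** Every [l n] lies below every [u m], so the supremum of the left endpoints works. *)
Lemma nested_intervals_inhabited (l u : nat -> R) :
  (forall n, l n <= l (S n)) -> (forall n, u (S n) <= u n) -> (forall n, l n <= u n) ->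
  exists c, forall n, l n <= c <= u n.
Proof.
intros Hl Hu Hlu.
assert (Lmon : forall n k, l n <= l (k + n)%nat).
{ intros n k. induction k as [|k IH]; simpl; [lra|].
  pose proof (Hl (k + n)%nat). lra. }
assert (Umon : forall n k, u (k + n)%nat <= u n).
{ intros n k. induction k as [|k IH]; simpl; [lra|].
  pose proof (Hu (k + n)%nat). lra. }
assert (LU : forall n m, l n <= u m).
{ intros n m. pose proof (Lmon n m). pose proof (Umon m n).
  pose proof (Hlu (m + n)%nat). rewrite (Nat.add_comm n m) in *. lra. }
destruct (completeness (fun x => exists n, x = l n)) as [c [Hc1 Hc2]].
- exists (u 0%nat). intros x [n ->]. apply LU.
- exists (l 0%nat). now exists 0%nat.
- exists c. intros n. split.
  + apply Hc1. now exists n.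
  + apply Hc2. intros x [m ->]. apply LU.
Qed.

(** Pigeonhole: the integral is the sum over the four quarters, so they cannot all be at most [K] in
    absolute value. *)
Lemma rect_integral_bisect (h : C -> C) (x y a b K : R) :
  0 <= a -> 0 <= b -> differentiable_on_rect h x (x + a) y (y + b) ->
  4 * K < Rabs (rect_integral h x (x + a) y (y + b)) ->
  exists x' y', (x' = x \/ x' = x + a / 2) /\ (y' = y \/ y' = y + b / 2) /\
    K < Rabs (rect_integral h x' (x' + a / 2) y' (y' + b / 2)).
Proof.
intros Ha Hb H HK.
rewrite (rect_integral_split_x h x (x + a / 2)) in HK by (exact H || lra).
rewrite (rect_integral_split_y h x (x + a / 2) y (y + b / 2) (y + b)) in HK
  by (lra || (revert H; apply differentiable_on_subrect; lra)).
rewrite (rect_integral_split_y h (x + a / 2) (x + a) y (y + b / 2) (y + b)) in HK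
  by (lra || (revert H; apply differentiable_on_subrect; lra)).
replace (x + a) with (x + a / 2 + a / 2) in HK by field.
replace (y + b) with (y + b / 2 + b / 2) in HK by field.
set (x' := x + a / 2) in *. set (y' := y + b / 2) in *.
set (I1 := rect_integral h x x' y y') in *.
set (I2 := rect_integral h x x' y' (y' + b / 2)) in *.
set (I3 := rect_integral h x' (x' + a / 2) y y') in *.
set (I4 := rect_integral h x' (x' + a / 2) y' (y' + b / 2)) in *.
destruct (Rlt_le_dec K (Rabs I1)); [exists x, y; auto|].
destruct (Rlt_le_dec K (Rabs I2)); [exists x, y'; auto|].
destruct (Rlt_le_dec K (Rabs I3)); [exists x', y; auto|].
destruct (Rlt_le_dec K (Rabs I4)); [exists x', y'; auto|].
exfalso.
pose proof (Rabs_triang (I1 + I2) (I3 + I4)).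
pose proof (Rabs_triang I1 I2). pose proof (Rabs_triang I3 I4). lra.
Qed.

(** Bisection is iterated on lower left corners; each step halves both sides and divides the bound
    by 4. The point (x0, y0) is common to all the nested rectangles. *)
Lemma rect_integral_nested (h : C -> C) (x y a b K : R) :
  0 <= a -> 0 <= b -> differentiable_on_rect h x (x + a) y (y + b) ->
  K < Rabs (rect_integral h x (x + a) y (y + b)) ->
  exists x0 y0, x <= x0 <= x + a /\ y <= y0 <= y + b /\
    forall n : nat, exists x1 y1,
      x <= x1 /\ x1 <= x0 <= x1 + a / 2 ^ n /\ x1 + a / 2 ^ n <= x + a /\
      y <= y1 /\ y1 <= y0 <= y1 + b / 2 ^ n /\ y1 + b / 2 ^ n <= y + b /\
      K / 4 ^ n < Rabs (rect_integral h x1 (x1 + a / 2 ^ n) y1 (y1 + b / 2 ^ n)).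
Proof.
intros Ha Hb H HK.
set (P := fun (n : nat) (p : R * R) =>
  x <= fst p /\ fst p + a / 2 ^ n <= x + a /\ y <= snd p /\ snd p + b / 2 ^ n <= y + b /\
  K / 4 ^ n < Rabs (rect_integral h (fst p) (fst p + a / 2 ^ n) (snd p) (snd p + b / 2 ^ n))).
assert (Hhalf : forall c n, c / 2 ^ S n = c / 2 ^ n / 2).
{ intros c n. simpl. field. apply pow_nonzero. lra. }
assert (Hpos : forall c n, 0 <= c -> 0 <= c / 2 ^ n).
{ intros c n Hc. apply Rdiv_le_0_compat; [exact Hc|]. apply pow_lt. lra. }
assert (Hstep : forall n p, P n p -> exists p', P (S n) p' /\
  fst p <= fst p' /\ fst p' + a / 2 ^ S n <= fst p + a / 2 ^ n /\
  snd p <= snd p' /\ snd p' + b / 2 ^ S n <= snd p + b / 2 ^ n).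
{ intros n p (P1 & P2 & P3 & P4 & P5).
  pose proof (Hpos a n Ha). pose proof (Hpos b n Hb).
  destruct (rect_integral_bisect h (fst p) (snd p) (a / 2 ^ n) (b / 2 ^ n) (K / 4 ^ S n))
    as (x' & y' & Hx' & Hy' & HI); try assumption.
  - revert H. apply differentiable_on_subrect; lra.
  - replace (4 * (K / 4 ^ S n)) with (K / 4 ^ n); [exact P5|].
    simpl. field. apply pow_nonzero. lra.
  - exists (x', y'). unfold P. rewrite !Hhalf. cbn [fst snd].
    repeat split; (exact HI || lra). }
assert (P0 : P 0%nat (x, y)).
{ unfold P. simpl. rewrite !Rdiv_1_r. repeat split; (exact HK || lra). }
(* Dependent choice: each term of the sequence [sq] carries its proof of the invariant [P]. *)
set (next := fun (n : nat) (s : {p | P n p}) =>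
  constructive_indefinite_description _ (Hstep n (proj1_sig s) (proj2_sig s))).
set (sq := fix sq (n : nat) : {p | P n p} := match n with
  | 0%nat => exist _ (x, y) P0
  | S m => exist _ (proj1_sig (next m (sq m))) (proj1 (proj2_sig (next m (sq m)))) end).
assert (Hsq : forall n,
  fst (proj1_sig (sq n)) <= fst (proj1_sig (sq (S n))) /\
  fst (proj1_sig (sq (S n))) + a / 2 ^ S n <= fst (proj1_sig (sq n)) + a / 2 ^ n /\
  snd (proj1_sig (sq n)) <= snd (proj1_sig (sq (S n))) /\
  snd (proj1_sig (sq (S n))) + b / 2 ^ S n <= snd (proj1_sig (sq n)) + b / 2 ^ n).
{ intros n. exact (proj2 (proj2_sig (next n (sq n)))). }
destruct (nested_intervals_inhabited (fun n => fst (proj1_sig (sq n)))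
  (fun n => fst (proj1_sig (sq n)) + a / 2 ^ n)) as [x0 Hx0].
- intros n. apply Hsq.
- intros n. apply Hsq.
- intros n. pose proof (Hpos a n Ha). lra.
- destruct (nested_intervals_inhabited (fun n => snd (proj1_sig (sq n)))
    (fun n => snd (proj1_sig (sq n)) + b / 2 ^ n)) as [y0 Hy0].
  + intros n. apply Hsq.
  + intros n. apply Hsq.
  + intros n. pose proof (Hpos b n Hb). lra.
  + exists x0, y0. split; [|split].
    * specialize (Hx0 0%nat). simpl in Hx0. rewrite Rdiv_1_r in Hx0. exact Hx0.
    * specialize (Hy0 0%nat). simpl in Hy0. rewrite Rdiv_1_r in Hy0. exact Hy0.
    * intros n. exists (fst (proj1_sig (sq n))), (snd (proj1_sig (sq n))).
      destruct (proj2_sig (sq n)) as (Q1 & Q2 & Q3 & Q4 & Q5).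
      repeat split; try assumption; (apply Hx0 || apply Hy0).
Qed.

(** A nonzero integral would leave more than K / 4^n on the n-th nested rectangle, while
    differentiability at the common point makes it at most a small multiple of 1 / 4^n. *)
Lemma goursat_rect (h : C -> C) (x1 x2 y1 y2 : R) :
  x1 <= x2 -> y1 <= y2 -> differentiable_on_rect h x1 x2 y1 y2 ->
  rect_integral h x1 x2 y1 y2 = 0.
Proof.
intros Hx Hy H.
destruct (Req_dec (rect_integral h x1 x2 y1 y2) 0) as [E|E]; [exact E|exfalso].
apply Rabs_pos_lt in E.
set (a := x2 - x1). set (b := y2 - y1).
replace x2 with (x1 + a) in * by (unfold a; ring).
replace y2 with (y1 + b) in * by (unfold b; ring).
(* Half the absolute value, so that the bisection can start from a strict inequality. *)
set (K := Rabs (rect_integral h x1 (x1 + a) y1 (y1 + b)) / 2).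
destruct (rect_integral_nested h x1 y1 a b K) as (x0 & y0 & Hx0 & Hy0 & HN);
  try (exact H || (unfold K; lra)); try lra.
destruct (H x0 y0 Hx0 Hy0) as [l Hl].
(* The added 1 keeps [s] positive for degenerate rectangles. With tolerance K / (2 s^2), the bound 2
   e (s q)^2 becomes exactly K q^2. *)
set (s := a + b + 1).
assert (Hs : 0 < s) by (unfold s; lra).
assert (HK : 0 < K) by (unfold K; lra).
assert (He : 0 < K / (2 * s ^ 2)).
{ apply Rdiv_lt_0_compat; [exact HK|]. pose proof (pow_lt s 2 Hs). lra. }
destruct (proj1 (is_Cderive_iff _ _ _) Hl _ He) as [d [Hd Hloc]].
destruct (pow_lt_1_zero (/ 2)) with (y := d / s) as [N HNd].
{ rewrite Rabs_pos_eq; lra. }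
{ apply Rdiv_lt_0_compat; lra. }
specialize (HNd N (le_n N)).
assert (Hq : 0 < (/ 2) ^ N) by (apply pow_lt; lra).
rewrite Rabs_pos_eq in HNd by lra.
destruct (HN N) as (u & v & U1 & U2 & U3 & V1 & V2 & V3 & HI).
set (q := (/ 2) ^ N) in *.
assert (Hqq : forall c, c / 2 ^ N = c * q).
{ intros c. unfold q. rewrite pow_inv. reflexivity. }
assert (Hq4 : K / 4 ^ N = K * q ^ 2).
{ unfold q. rewrite pow_inv.
  replace 4 with (2 * 2) by ring. rewrite Rpow_mult_distr.
  field. apply pow_nonzero. lra. }
rewrite !Hqq in *. rewrite Hq4 in HI.
assert (Hqs : q * s < d).
{ apply (Rmult_lt_compat_r s) in HNd; [|exact Hs].
  replace (d / s * s) with d in HNd by (field; lra). exact HNd. }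
assert (Hsub : differentiable_on_rect h u (u + a * q) v (v + b * q))
  by (revert H; apply differentiable_on_subrect; lra).
apply (Rlt_irrefl (K * q ^ 2)).
eapply Rlt_le_trans; [exact HI|].
eapply Rle_trans.
- apply (rect_integral_small h (x0, y0) l d (K / (2 * s ^ 2)));
    try (exact Hloc || exact Hsub); cbn [Re Im fst snd]; try lra.
  unfold s in Hqs. clear - Hqs Hq. nra.
- replace (u + a * q - u + (v + b * q - v)) with ((a + b) * q) by ring.
  apply Rle_trans with (2 * (K / (2 * s ^ 2)) * (s * q) ^ 2).
  + apply Rmult_le_compat_l; [lra|]. apply pow_incr.
    split; [apply Rmult_le_pos; lra|]. unfold s. nra.
  + right. field. lra.
Qed.

(** * Schwarz and Schwarz-Pick *)

Definition Cexp (z : C) : C := (exp (Re z) * cos (Im z), exp (Re z) * sin (Im z)).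

Lemma Cexp_plus (z w : C) : Cexp (z + w)%C = (Cexp z * Cexp w)%C.
Proof.
destruct z as [a b], w as [c d].
unfold Cexp, Cplus, Cmult. cbn [Re Im fst snd].
rewrite exp_plus, cos_plus, sin_plus. f_equal; ring.
Qed.

Lemma Cmod_Cexp (z : C) : Cmod (Cexp z) = exp (Re z).
Proof.
unfold Cmod, Cexp. cbn [fst snd].
replace ((exp (Re z) * cos (Im z)) ^ 2 + (exp (Re z) * sin (Im z)) ^ 2)
  with (exp (Re z) * exp (Re z) * (Rsqr (sin (Im z)) + Rsqr (cos (Im z))))
  by (unfold Rsqr; ring).
rewrite sin2_cos2, Rmult_1_r. apply sqrt_square. left. apply exp_pos.
Qed.

Lemma Cexp_2PI (x : R) : Cexp (x, 2 * PI) = Cexp (x, 0).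
Proof.
unfold Cexp. cbn [Re Im fst snd]. now rewrite cos_2PI, sin_2PI, cos_0, sin_0.
Qed.

(** Clearing the quotient admits h = 0, which occurs when one coordinate of a complex increment
    vanishes. *)
Lemma derivable_pt_lim_remainder (f : R -> R) (x l e : R) :
  derivable_pt_lim f x l -> 0 < e ->
  exists d, 0 < d /\ forall h, Rabs h < d -> Rabs (f (x + h) - f x - l * h) <= e * Rabs h.
Proof.
intros H He. destruct (H e He) as [d Hd].
exists d. split; [apply cond_pos|]. intros h Hh.
destruct (Req_dec h 0) as [->|Hh0].
- rewrite Rplus_0_r, Rabs_R0.
  replace (f x - f x - l * 0) with 0 by ring. rewrite Rabs_R0. lra.
- specialize (Hd h Hh0 Hh).
  replace (f (x + h) - f x - l * h) with (((f (x + h) - f x) / h - l) * h) by (field; exact Hh0).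
  rewrite Rabs_mult. apply Rmult_le_compat_r; [apply Rabs_pos|lra].
Qed.

Lemma is_Cderive_Cexp_0 : is_Cderive Cexp 0 1.
Proof.
apply is_Cderive_iff. intros e0 He0.
(* With y = s + i t, the remainder splits into four terms bounded by e |s|, 3 e |t|, 4 e |t| and e
   |t|, hence by 9 e |y|. The bound e <= 1 gives |s| < 1, so exp s <= 3. *)
set (e := Rmin 1 (e0 / 9)).
assert (He : 0 < e) by (apply Rmin_pos; lra).
assert (He1 : e <= 1) by apply Rmin_l.
assert (He9 : 9 * e <= e0) by (unfold e; pose proof (Rmin_r 1 (e0 / 9)); lra).
destruct (derivable_pt_lim_remainder exp 0 _ e (derivable_pt_lim_exp 0) He) as [d1 [Hd1 H1]].
destruct (derivable_pt_lim_remainder cos 0 _ e (derivable_pt_lim_cos 0) He) as [d2 [Hd2 H2]].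
destruct (derivable_pt_lim_remainder sin 0 _ e (derivable_pt_lim_sin 0) He) as [d3 [Hd3 H3]].
rewrite exp_0 in H1. rewrite cos_0, sin_0 in H2. rewrite cos_0, sin_0 in H3.
exists (Rmin e (Rmin d1 (Rmin d2 d3))).
split; [repeat apply Rmin_pos; lra|].
intros y Hy.
replace (Cexp y - Cexp (RtoC 0) - RtoC 1 * (y - RtoC 0))%C
  with (Cexp y - RtoC 1 - y)%C.
2:{ replace (Cexp (RtoC 0)) with (RtoC 1); [ring|].
    unfold Cexp. cbn. rewrite exp_0, cos_0, sin_0. unfold RtoC. f_equal; ring. }
replace (y - RtoC 0)%C with y in * by ring.
pose proof (Rmin_l e (Rmin d1 (Rmin d2 d3))).
pose proof (Rmin_r e (Rmin d1 (Rmin d2 d3))).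
pose proof (Rmin_l d1 (Rmin d2 d3)). pose proof (Rmin_r d1 (Rmin d2 d3)).
pose proof (Rmin_l d2 d3). pose proof (Rmin_r d2 d3).
pose proof (re_le_Cmod y) as Hs. pose proof (im_le_Cmod y) as Ht.
specialize (H1 (Re y) ltac:(lra)). specialize (H2 (Im y) ltac:(lra)).
specialize (H3 (Im y) ltac:(lra)). rewrite Rplus_0_l in H1, H2, H3.
set (s := Re y) in *. set (t := Im y) in *. set (m := Cmod y) in *.
assert (Hexp : exp s <= 3).
{ apply Rle_trans with (exp 1); [|exact exp_le_3].
  left. apply exp_increasing.
  assert (Rabs s < 1 \/ Rabs s >= 1) as [Q|Q] by lra; [|lra].
  apply Rabs_def2 in Q. lra. }
pose proof (exp_pos s) as Hexp0.
pose proof (Rabs_pos s). pose proof (Rabs_pos t).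
replace (Cexp y - RtoC 1 - y)%C with
  ((exp s - 1 - 1 * s) + exp s * (cos t - 1 - - 0 * t),
   (exp s - 1) * sin t + (sin t - 0 - 1 * t)).
2:{ unfold Cexp, RtoC, Cminus, Cplus, Copp. destruct y as [a b].
    unfold s, t. cbn [Re Im fst snd]. f_equal; ring. }
eapply Rle_trans; [apply Cmod_le_Rabs|].
eapply Rle_trans; [apply Rplus_le_compat; apply Rabs_triang|].
rewrite !Rabs_mult, (Rabs_pos_eq (exp s)) by lra.
assert (E1 : Rabs (exp s - 1) <= 2 * Rabs s).
{ replace (exp s - 1) with ((exp s - 1 - 1 * s) + s) by ring.
  eapply Rle_trans; [apply Rabs_triang|]. nra. }
assert (E2 : Rabs (sin t) <= 2 * Rabs t).
{ replace (sin t) with ((sin t - 0 - 1 * t) + t) by ring.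
  eapply Rle_trans; [apply Rabs_triang|]. nra. }
assert (E3 : Rabs (exp s - 1) * Rabs (sin t) <= (2 * Rabs s) * (2 * Rabs t))
  by (apply Rmult_le_compat; auto using Rabs_pos).
assert (E4 : exp s * Rabs (cos t - 1 - - 0 * t) <= 3 * (e * Rabs t))
  by (apply Rmult_le_compat; auto using Rabs_pos; lra).
assert (E5 : Rabs s * Rabs t <= e * Rabs t) by (apply Rmult_le_compat_r; lra).
assert (E6 : e * Rabs s <= e * m) by (apply Rmult_le_compat_l; lra).
assert (E7 : e * Rabs t <= e * m) by (apply Rmult_le_compat_l; lra).
assert (E8 : 9 * e * m <= e0 * m) by (apply Rmult_le_compat_r; lra).
lra.
Qed.

Lemma is_Cderive_Cexp (z : C) : is_Cderive Cexp z (Cexp z).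
Proof.
assert (H : is_Cderive (fun y => Cexp z * Cexp (y - z)%C)%C z (Cexp z)).
{ apply is_Cderive_eq with (0 * Cexp (z - z) + Cexp z * (1 * 1))%C; [|ring].
  apply (is_Cderive_mult (fun _ => Cexp z) (fun y => Cexp (y - z)%C)).
  - apply is_Cderive_const.
  - apply (is_Cderive_comp Cexp (fun y => y - z)%C).
    + replace (z - z)%C with (RtoC 0) by ring. apply is_Cderive_Cexp_0.
    + replace (RtoC 1) with (1 + 0)%C by ring.
      apply (is_Cderive_plus (fun y => y) (fun _ => - z)%C);
        [apply is_Cderive_id|apply is_Cderive_const]. }
apply (is_Cderive_ext_near _ _ _ _ 1 Rlt_0_1) with (2 := H).
intros y _. rewrite <- Cexp_plus. f_equal. ring.
Qed.

(** * Circle means, the maximum principle at the centre and Schwarz's lemma *)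

Definition punctured_differentiable (k : C -> C) : Prop :=
  forall z, 0 < Cmod z < 1 -> exists l, is_Cderive k z l.

Lemma polar_differentiable (k : C -> C) (x1 x2 y1 y2 : R) :
  punctured_differentiable k -> x2 < 0 ->
  differentiable_on_rect (fun z => k (Cexp z)) x1 x2 y1 y2.
Proof.
intros Hk H x y Hx Hy.
destruct (Hk (Cexp (x, y))) as [l Hl].
- rewrite Cmod_Cexp. cbn [Re fst]. split; [apply exp_pos|].
  rewrite <- exp_0. apply exp_increasing. lra.
- eexists. apply (is_Cderive_comp k Cexp); [exact Hl|apply is_Cderive_Cexp].
Qed.

(* Goursat in the coordinate log z: the two horizontal sides cancel by
   2 pi i-periodicity of the exponential. *)
Lemma circle_mean_constant (k : C -> C) (t0 t1 : R) :
  punctured_differentiable k -> t0 <= t1 -> t1 < 0 ->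
  RInt (fun y => Re (k (Cexp (t0, y)))) 0 (2 * PI) =
  RInt (fun y => Re (k (Cexp (t1, y)))) 0 (2 * PI).
Proof.
intros Hk H01 H1. pose proof PI_RGT_0.
assert (Hd : differentiable_on_rect (fun z => k (Cexp z)) t0 t1 0 (2 * PI))
  by (apply polar_differentiable; assumption).
assert (G := goursat_rect _ t0 t1 0 (2 * PI) H01 ltac:(lra) Hd).
rewrite rect_integral_eq in G by (exact Hd || lra).
assert (E : RInt (fun x => Im (k (Cexp (x, 2 * PI)))) t0 t1 =
            RInt (fun x => Im (k (Cexp (x, 0)))) t0 t1).
{ apply RInt_ext. intros x _. now rewrite Cexp_2PI. }
cbv beta in G. rewrite E in G. lra.
Qed.

(** The mean of [Re k] over a circle does not depend on the radius: it is at least m - e on a small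
    circle and at most [M] on the circle of radius [rho]. The behaviour at 0 enters through a lower
    limit bound, so that [k] may be a quotient g z / z. *)
Lemma max_principle_center (k : C -> C) (m M rho : R) :
  punctured_differentiable k -> 0 < rho < 1 ->
  (forall z, Cmod z = rho -> Re (k z) <= M) ->
  (forall e, 0 < e -> exists d, 0 < d /\
     forall z, 0 < Cmod z < d -> m - e <= Re (k z)) ->
  m <= M.
Proof.
intros Hk Hrho HM Hm. apply le_epsilon. intros e He.
destruct (Hm e He) as [d [Hd Hmd]].
(* In the coordinate log z, the circles of radii c < min(d, rho) and [rho] become vertical
   segments. *)
set (t1 := ln rho). set (c := Rmin d rho / 2). set (t0 := ln c).
pose proof (Rmin_l d rho). pose proof (Rmin_r d rho).
assert (0 < Rmin d rho) by (apply Rmin_pos; lra).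
assert (Hc : 0 < c < d /\ c < rho) by (unfold c; lra).
assert (E0 : exp t0 = c) by (apply exp_ln; lra).
assert (E1 : exp t1 = rho) by (apply exp_ln; lra).
assert (H01 : t0 <= t1) by (left; apply ln_increasing; lra).
assert (Ht1 : t1 < 0) by (rewrite <- ln_1; apply ln_increasing; lra).
pose proof PI_RGT_0 as HPI.
assert (G := circle_mean_constant k t0 t1 Hk H01 Ht1).
assert (Hex : forall t, t < 0 ->
  ex_RInt (fun y => Re (k (Cexp (t, y)))) 0 (2 * PI)).
{ intros t Ht. apply (ex_RInt_vertical (fun z => k (Cexp z)) t t 0 (2 * PI)); try lra.
  now apply polar_differentiable. }
assert (L0 : (2 * PI - 0) * (m - e) <= RInt (fun y => Re (k (Cexp (t0, y)))) 0 (2 * PI)).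
{ apply Rle_trans with (RInt (fun _ => m - e) 0 (2 * PI));
    [right; rewrite RInt_const; reflexivity|].
  apply RInt_le; [lra|apply ex_RInt_const|apply Hex; lra|].
  intros y _. apply Hmd. rewrite Cmod_Cexp. cbn [Re fst]. lra. }
assert (L1 : RInt (fun y => Re (k (Cexp (t1, y)))) 0 (2 * PI) <= (2 * PI - 0) * M).
{ apply Rle_trans with (RInt (fun _ => M) 0 (2 * PI));
    [|right; rewrite RInt_const; reflexivity].
  apply RInt_le; [lra|apply Hex; lra|apply ex_RInt_const|].
  intros y _. apply HM. rewrite Cmod_Cexp. exact E1. }
assert (Q : (2 * PI) * (m - e) <= (2 * PI) * M) by lra.
apply Rmult_le_reg_l in Q; lra.
Qed.

(** If |l| = m > 1, a unimodular factor [c] turns [l] into the real number m. Then c g(z) / z tends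
    to m at 0 and is at most 1 / rho in modulus on |z| = rho, so the maximum principle gives m <= 1
    / rho. *)
Lemma schwarz_derivative (g : C -> C) (l : C) :
  punctured_differentiable g -> g (RtoC 0) = RtoC 0 ->
  (forall z, Cmod z < 1 -> Cmod (g z) <= 1) ->
  is_Cderive g 0 l -> Cmod l <= 1.
Proof.
intros Hg Hg0 Hg1 Hl.
destruct (Rle_or_lt (Cmod l) 1) as [H|H]; [exact H|exfalso].
set (m := Cmod l) in *.
assert (Hm0 : RtoC m <> RtoC 0) by (intros E; apply RtoC_inj in E; lra).
set (c := (Cconj l / RtoC m)%C).
assert (Hc : Cmod c = 1).
{ unfold c. rewrite Cmod_div by exact Hm0.
  rewrite Cmod_conj, Cmod_R, Rabs_pos_eq by lra. fold m. field. lra. }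
assert (Hcl : (c * l)%C = RtoC m).
{ unfold c. replace (Cconj l / RtoC m * l)%C with (l * Cconj l / RtoC m)%C
    by (field; exact Hm0).
  rewrite <- Cmod2_conj. fold m. rewrite RtoC_pow. field. exact Hm0. }
(* The midpoint of 1 / m and 1, so that m rho = (m + 1) / 2 > 1, a contradiction. *)
set (rho := (1 + / m) / 2).
assert (Him : 0 < / m < 1).
{ split; [apply Rinv_0_lt_compat; lra|]. rewrite <- Rinv_1. apply Rinv_lt_contravar; lra. }
assert (Hrho : 0 < rho < 1) by (unfold rho; lra).
assert (Hle : m <= / rho).
{ apply (max_principle_center (fun z => c * (g z * / z))%C m (/ rho) rho).
  - intros z Hz. destruct (Hg z Hz) as [d Hd].
    assert (Hz0 : z <> RtoC 0) by (apply Cmod_gt_0; lra).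
    eexists. apply (is_Cderive_mult (fun _ => c) (fun z => g z * / z)%C);
      [apply is_Cderive_const|].
    apply (is_Cderive_mult g Cinv); [exact Hd|].
    apply is_Cderive_Cinv, Hz0.
  - exact Hrho.
  - intros z Hz.
    assert (Hz0 : z <> RtoC 0) by (apply Cmod_gt_0; lra).
    eapply Rle_trans; [apply Rle_abs|].
    eapply Rle_trans; [apply re_le_Cmod|].
    rewrite !Cmod_mult, Cmod_inv, Hc, Hz by exact Hz0.
    pose proof (Hg1 z ltac:(lra)).
    assert (0 < / rho) by (apply Rinv_0_lt_compat; lra). nra.
  - intros e He. destruct (proj1 (is_Cderive_iff _ _ _) Hl e He) as [d [Hd H1]].
    exists d. split; [exact Hd|]. intros z Hz.
    assert (Hz0 : z <> RtoC 0) by (apply Cmod_gt_0; lra).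
    specialize (H1 z). rewrite Hg0 in H1.
    replace (z - RtoC 0)%C with z in H1 by ring.
    specialize (H1 ltac:(lra)).
    assert (B : Cmod (c * (g z * / z) - RtoC m)%C <= e).
    { rewrite <- Hcl.
      replace (c * (g z * / z) - c * l)%C with (c * (g z - RtoC 0 - l * z) * / z)%C
        by (field; exact Hz0).
      rewrite !Cmod_mult, Cmod_inv, Hc, Rmult_1_l by exact Hz0.
      apply (Rmult_le_reg_r (Cmod z)); [lra|].
      rewrite Rmult_assoc, Rinv_l by lra. lra. }
    pose proof (Rle_trans _ _ _ (Re_lip _ _) B) as B'.
    change (Re (RtoC m)) with m in B'.
    apply Rabs_le_between in B'. lra. }
apply (Rmult_le_compat_r rho) in Hle; [|lra].
rewrite Rinv_l in Hle by lra.
assert (m * rho = (m + 1) / 2) by (unfold rho; field; lra). lra.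
Qed.

(** * Disk automorphisms and the Schwarz-Pick inequality for the half-plane *)

Lemma Cmod_le_of_sqr (u v : C) :
  Re u ^ 2 + Im u ^ 2 <= Re v ^ 2 + Im v ^ 2 -> Cmod u <= Cmod v.
Proof. intros H. apply sqrt_le_1_alt. exact H. Qed.

Lemma Cmod_lt_of_sqr (u v : C) :
  Re u ^ 2 + Im u ^ 2 < Re v ^ 2 + Im v ^ 2 -> Cmod u < Cmod v.
Proof.
intros H. apply sqrt_lt_1_alt. split; [|exact H].
pose proof (pow2_ge_0 (fst u)). pose proof (pow2_ge_0 (snd u)). lra.
Qed.

Lemma Cmod_lt_1_sqr (z : C) : Cmod z < 1 -> Re z ^ 2 + Im z ^ 2 < 1.
Proof. intros H. rewrite <- Cmod2_alt. pose proof (Cmod_ge_0 z). nra. Qed.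

Definition moebius (a z : C) : C := ((z + a) * / (1 + Cconj a * z))%C.

Lemma moebius_den_neq_0 (a z : C) :
  Cmod a < 1 -> Cmod z < 1 -> (1 + Cconj a * z)%C <> RtoC 0.
Proof.
intros Ha Hz E.
assert (H : Cmod (Cconj a * z)%C = 1).
{ replace (Cconj a * z)%C with (- RtoC 1 + (1 + Cconj a * z))%C by ring.
  rewrite E, Cplus_0_r, Cmod_opp, Cmod_R. apply Rabs_R1. }
rewrite Cmod_mult, Cmod_conj in H.
pose proof (Cmod_ge_0 a). pose proof (Cmod_ge_0 z). nra.
Qed.

Lemma moebius_disk (a z : C) : Cmod a < 1 -> Cmod z < 1 -> Cmod (moebius a z) < 1.
Proof.
intros Ha Hz. pose proof (moebius_den_neq_0 a z Ha Hz) as Hn.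
unfold moebius. rewrite Cmod_mult, Cmod_inv by exact Hn.
apply Cmod_gt_0 in Hn.
apply (Rmult_lt_reg_r (Cmod (1 + Cconj a * z))); [exact Hn|].
rewrite Rmult_assoc, Rinv_l, Rmult_1_l, Rmult_1_r by lra.
apply Cmod_lt_of_sqr. apply Cmod_lt_1_sqr in Ha. apply Cmod_lt_1_sqr in Hz.
destruct a as [b c], z as [x y].
unfold Re, Im, Cconj, Cplus, Cmult, RtoC in *. cbn [fst snd] in *.
(* This product is |1 + conj(a) z|^2 - |z + a|^2. *)
assert (0 < (1 - (b ^ 2 + c ^ 2)) * (1 - (x ^ 2 + y ^ 2))) by (apply Rmult_lt_0_compat; lra).
nra.
Qed.

(** The derivative keeps the shape produced by the rules; it is simplified only at z = 0, where it
    equals 1 - |a|^2. *)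
Lemma is_Cderive_moebius (a z : C) :
  Cmod a < 1 -> Cmod z < 1 ->
  is_Cderive (moebius a) z
    ((1 + 0) * / (1 + Cconj a * z) +
     (z + a) * ((0 + (0 * z + Cconj a * 1)) *
       - / ((1 + Cconj a * z) * (1 + Cconj a * z))))%C.
Proof.
intros Ha Hz.
apply (is_Cderive_mult (fun z => z + a)%C (fun z => / (1 + Cconj a * z))%C).
- apply (is_Cderive_plus (fun z => z) (fun _ => a));
    [apply is_Cderive_id|apply is_Cderive_const].
- apply (is_Cderive_inv (fun z => 1 + Cconj a * z)%C).
  + now apply moebius_den_neq_0.
  + apply (is_Cderive_plus (fun _ => RtoC 1) (fun z => Cconj a * z)%C);
      [apply is_Cderive_const|].
    apply (is_Cderive_mult (fun _ => Cconj a) (fun z => z));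
      [apply is_Cderive_const|apply is_Cderive_id].
Qed.

Definition disk_differentiable (P : C -> C) : Prop :=
  forall z, Cmod z < 1 -> exists l, is_Cderive P z l.

(** With b = P a, precompose [P] with the disk automorphism taking 0 to [a], and postcompose with
    the Cayley map u -> (u - b) / (u + conj b) from the half-plane to the disk. The result fixes 0
    with derivative (1 - |a|^2) l / (2 Re b), and Schwarz's lemma applies. *)
Lemma schwarz_pick_half_plane_pos (P : C -> C) (a l : C) :
  disk_differentiable P -> (forall z, Cmod z < 1 -> 0 < Re (P z)) ->
  Cmod a < 1 -> is_Cderive P a l ->
  Cmod l * (1 - Cmod a ^ 2) <= 2 * Re (P a).
Proof.
intros HP Hpos Ha Hl.
set (Q := fun z => P (moebius a z)).
assert (HQ : forall z, Cmod z < 1 -> 0 < Re (Q z)).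
{ intros z Hz. apply Hpos. now apply moebius_disk. }
assert (H0 : Cmod (RtoC 0) < 1) by (rewrite Cmod_0; lra).
assert (Hma : moebius a (RtoC 0) = a) by (unfold moebius; field).
assert (HQ0 : Q (RtoC 0) = P a) by (unfold Q; now rewrite Hma).
assert (HQd : forall z, Cmod z < 1 -> exists m, is_Cderive Q z m).
{ intros z Hz. destruct (HP (moebius a z)) as [d Hd]; [now apply moebius_disk|].
  eexists. apply (is_Cderive_comp P (moebius a)); [exact Hd|].
  now apply is_Cderive_moebius. }
assert (HQ0' : is_Cderive Q 0 (RtoC (1 - Cmod a ^ 2) * l)).
{ replace (RtoC (1 - Cmod a ^ 2)) with
    ((1 + 0) * / (1 + Cconj a * 0) +
     (0 + a) * ((0 + (0 * 0 + Cconj a * 1)) *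
       - / ((1 + Cconj a * 0) * (1 + Cconj a * 0))))%C.
  - apply (is_Cderive_comp P (moebius a)); [now rewrite Hma|].
    now apply is_Cderive_moebius.
  - rewrite RtoC_minus, Cmod2_conj. field. }
set (b := P a) in *. set (B := Cconj b).
assert (Hb : 0 < Re b) by (rewrite <- HQ0; now apply HQ).
assert (Hden : forall z, Cmod z < 1 -> (Q z + B)%C <> RtoC 0).
{ intros z Hz E. apply (f_equal Re) in E.
  change (Re (Q z) + Re b = 0) in E. specialize (HQ z Hz). lra. }
assert (HbB : (b + B)%C = RtoC (2 * Re b)).
{ unfold B. destruct b as [x y].
  unfold Cplus, Cconj, RtoC. cbn [fst snd Re]. f_equal; ring. }
assert (Hgd : forall z m, Cmod z < 1 -> is_Cderive Q z m ->
  is_Cderive (fun z => (Q z + - b) * / (Q z + B))%C z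
    ((m + 0) * / (Q z + B) +
     (Q z + - b) * ((m + 0) * - / ((Q z + B) * (Q z + B))))).
{ intros z m Hz Hm.
  apply (is_Cderive_mult (fun z => Q z + - b)%C (fun z => / (Q z + B))%C).
  - apply (is_Cderive_plus Q (fun _ => - b)%C); [exact Hm|apply is_Cderive_const].
  - apply (is_Cderive_inv (fun z => Q z + B)%C); [now apply Hden|].
    apply (is_Cderive_plus Q (fun _ => B)); [exact Hm|apply is_Cderive_const]. }
assert (S := schwarz_derivative (fun z => (Q z + - b) * / (Q z + B))%C
  (RtoC (1 - Cmod a ^ 2) * l * / RtoC (2 * Re b))%C).
assert (Hr : RtoC (2 * Re b) <> RtoC 0) by (intros E; apply RtoC_inj in E; lra).
rewrite !Cmod_mult, Cmod_inv, !Cmod_R in S by exact Hr.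
rewrite (Rabs_pos_eq (2 * Re b)), (Rabs_pos_eq (1 - Cmod a ^ 2)) in S
  by (pose proof (Cmod_ge_0 a); nra).
apply (Rmult_le_reg_r (/ (2 * Re b))); [apply Rinv_0_lt_compat; lra|].
rewrite (Rinv_r (2 * Re b)), (Rmult_comm (Cmod l)) by lra.
apply S.
- intros z Hz. destruct (HQd z) as [m Hm]; [lra|]. eexists. apply Hgd; [lra|exact Hm].
- rewrite HQ0. ring.
- intros z Hz. rewrite Cmod_mult, Cmod_inv by now apply Hden.
  pose proof (proj1 (Cmod_gt_0 _) (Hden z Hz)) as Hp.
  apply (Rmult_le_reg_r (Cmod (Q z + B))); [exact Hp|].
  rewrite Rmult_assoc, Rinv_l, Rmult_1_l, Rmult_1_r by lra.
  (* The difference of the squares is 4 Re (Q z) Re b. *)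
  apply Cmod_le_of_sqr. specialize (HQ z Hz).
  unfold B. destruct (Q z) as [x y], b as [u v].
  unfold Re, Im, Cconj, Cplus, Copp in *. cbn [fst snd] in *. nra.
- specialize (Hgd _ _ H0 HQ0'). rewrite HQ0, HbB in Hgd.
  replace (RtoC (1 - Cmod a ^ 2) * l * / RtoC (2 * Re b))%C with
    ((RtoC (1 - Cmod a ^ 2) * l + 0) * / RtoC (2 * Re b) +
     (b + - b) * ((RtoC (1 - Cmod a ^ 2) * l + 0) *
        - / (RtoC (2 * Re b) * RtoC (2 * Re b))))%C; [exact Hgd|].
  field. exact Hr.
Qed.

(** Adding e / 2 to [P] makes its real part positive, keeps the derivative and raises the right-hand
    side by e. *)
Lemma schwarz_pick_half_plane (P : C -> C) (a l : C) :
  disk_differentiable P -> (forall z, Cmod z < 1 -> 0 <= Re (P z)) ->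
  Cmod a < 1 -> is_Cderive P a l ->
  Cmod l * (1 - Cmod a ^ 2) <= 2 * Re (P a).
Proof.
intros HP Hpos Ha Hl. apply le_epsilon. intros e He.
assert (Hd : forall z m, is_Cderive P z m ->
  is_Cderive (fun z => P z + RtoC (e / 2))%C z m).
{ intros z m Hm. replace m with (m + 0)%C by ring.
  apply (is_Cderive_plus P (fun _ => RtoC (e / 2))); [exact Hm|apply is_Cderive_const]. }
assert (S := schwarz_pick_half_plane_pos (fun z => P z + RtoC (e / 2))%C a l).
change (Re (P a + RtoC (e / 2))%C) with (Re (P a) + e / 2) in S.
replace (2 * Re (P a) + e) with (2 * (Re (P a) + e / 2)) by field.
apply S; [| |exact Ha|now apply Hd].
- intros z Hz. destruct (HP z Hz) as [m Hm]. exists m. now apply Hd.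
- intros z Hz. specialize (Hpos z Hz).
  change (0 < Re (P z) + e / 2). lra.
Qed.

(** * Harnack's inequality and the resolvent estimate *)

Lemma is_derive_along_ray (P : C -> C) (z l : C) (t : R) :
  is_Cderive P (RtoC t * z) l ->
  is_derive (fun s : R => Re (P (RtoC s * z)%C)) t (Re (l * z)%C).
Proof.
intros H. apply is_derive_Reals. intros e He.
pose proof (Cmod_ge_0 z).
(* Since |z| / (2 (|z| + 1)) <= 1 / 2, the error is at most e |h| / 2, which gives the strict bound;
   the added 1 covers z = 0. *)
assert (Hz : 0 < / (2 * (Cmod z + 1))) by (apply Rinv_0_lt_compat; lra).
destruct (proj1 (is_Cderive_iff _ _ _) H (e * / (2 * (Cmod z + 1)))) as [d [Hd H1]];
  [apply Rmult_lt_0_compat; lra|].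
assert (Hd' : 0 < d * / (2 * (Cmod z + 1))) by (apply Rmult_lt_0_compat; lra).
exists (mkposreal _ Hd'). intros h Hh Hhd. cbn [pos] in Hhd.
pose proof (Rabs_pos_lt h Hh) as Hh0.
assert (Ez : Cmod (RtoC (t + h) * z - RtoC t * z)%C = Rabs h * Cmod z).
{ replace (RtoC (t + h) * z - RtoC t * z)%C with (RtoC h * z)%C
    by (rewrite RtoC_plus; ring).
  now rewrite Cmod_mult, Cmod_R. }
assert (Hk : Cmod z * / (2 * (Cmod z + 1)) <= / 2).
{ apply (Rmult_le_reg_r (2 * (Cmod z + 1))); [lra|].
  rewrite Rmult_assoc, Rinv_l by lra. lra. }
specialize (H1 (RtoC (t + h) * z)%C). rewrite Ez in H1.
assert (Hhz : Rabs h * Cmod z < d).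
{ apply Rle_lt_trans with (d * / (2 * (Cmod z + 1)) * Cmod z).
  - apply Rmult_le_compat_r; lra.
  - rewrite Rmult_assoc, (Rmult_comm (/ _)). nra. }
specialize (H1 Hhz).
replace (RtoC (t + h) * z - RtoC t * z)%C with (RtoC h * z)%C in H1
  by (rewrite RtoC_plus; ring).
apply (Rmult_lt_reg_r (Rabs h)); [exact Hh0|].
rewrite <- Rabs_mult.
replace (((Re (P (RtoC (t + h) * z)%C) - Re (P (RtoC t * z)%C)) / h - Re (l * z)%C) * h)
  with (Re (P (RtoC (t + h) * z) - P (RtoC t * z) - l * (RtoC h * z))%C).
- eapply Rle_lt_trans; [apply re_le_Cmod|].
  eapply Rle_lt_trans; [exact H1|].
  assert (e * (Rabs h * (Cmod z * / (2 * (Cmod z + 1)))) <= e * (Rabs h * / 2))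
    by (repeat apply Rmult_le_compat_l; lra).
  assert (0 < e * Rabs h) by (apply Rmult_lt_0_compat; lra).
  lra.
- unfold Re, Cminus, Cplus, Copp, Cmult, RtoC. cbn [fst snd]. field. exact Hh.
Qed.

Lemma Cmod_ray (z : C) (t : R) : 0 <= t -> Cmod (RtoC t * z) = t * Cmod z.
Proof. intros Ht. now rewrite Cmod_mult, Cmod_R, Rabs_pos_eq. Qed.

(* Schwarz-Pick says exactly that Re P(tz) (1 + t|z|) / (1 - t|z|) is
   nondecreasing in t. *)
Lemma harnack_half_plane (P : C -> C) (z : C) :
  disk_differentiable P -> (forall z, Cmod z < 1 -> 0 <= Re (P z)) ->
  Cmod z < 1 ->
  Re (P (RtoC 0)) * (1 - Cmod z) <= Re (P z) * (1 + Cmod z).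
Proof.
intros HP Hpos Hz. pose proof (Cmod_ge_0 z) as Hz0.
set (rho := Cmod z) in *.
set (F := fun t : R => Re (P (RtoC t * z)%C) * ((1 + t * rho) / (1 - t * rho))).
assert (HF : forall t, 0 <= t <= 1 -> exists v, 0 <= v /\ is_derive F t v).
{ intros t Ht.
  assert (Hm : Cmod (RtoC t * z) = t * rho) by (apply Cmod_ray; lra).
  assert (Htr : 0 <= t * rho < 1) by nra.
  destruct (HP (RtoC t * z)%C) as [l Hl]; [lra|].
  pose proof (schwarz_pick_half_plane P (RtoC t * z)%C l HP Hpos ltac:(lra) Hl) as S.
  rewrite Hm in S.
  exists (Re (l * z)%C * ((1 + t * rho) / (1 - t * rho)) +
          Re (P (RtoC t * z)%C) * (2 * rho / (1 - t * rho) ^ 2)).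
  split.
  - assert (B : - (Cmod l * rho) <= Re (l * z)%C).
    { pose proof (re_le_Cmod (l * z)%C) as B. rewrite Cmod_mult in B.
      apply Rabs_le_between in B. fold rho in B. lra. }
    (* Over the common denominator, the numerator is nonnegative by Re (l z) >= - |l| rho and
       Schwarz-Pick at t z. *)
    replace (Re (l * z)%C * ((1 + t * rho) / (1 - t * rho)) +
             Re (P (RtoC t * z)%C) * (2 * rho / (1 - t * rho) ^ 2))
      with ((Re (l * z)%C * (1 - (t * rho) ^ 2) + 2 * Re (P (RtoC t * z)%C) * rho)
            / (1 - t * rho) ^ 2) by (field; lra).
    apply Rdiv_le_0_compat; [|apply pow_lt; lra].
    assert (- (Cmod l * rho) * (1 - (t * rho) ^ 2) <= Re (l * z)%C * (1 - (t * rho) ^ 2))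
      by (apply Rmult_le_compat_r; [nra|exact B]).
    assert (Cmod l * (1 - (t * rho) ^ 2) * rho <= 2 * Re (P (RtoC t * z)%C) * rho)
      by (apply Rmult_le_compat_r; lra).
    lra.
  - apply (@is_derive_mult R_AbsRing (fun t : R => Re (P (RtoC t * z)%C))
      (fun t => (1 + t * rho) / (1 - t * rho))).
    + now apply is_derive_along_ray.
    + auto_derive; [lra|]. field. lra.
    + apply Rmult_comm. }
(* The mean value theorem yields F 0 <= F 1, which is the claim after division by 1 - rho. *)
destruct (MVT_gen F 0 1 (Derive F)) as [c [Hc HM]].
- intros t. rewrite Rmin_left, Rmax_right by lra. intros Ht.
  destruct (HF t ltac:(lra)) as [v [_ Hv]]. apply Derive_correct. now exists v.
- intros t. rewrite Rmin_left, Rmax_right by lra. intros Ht.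
  destruct (HF t Ht) as [v [_ Hv]].
  apply continuity_pt_filterlim. apply (@ex_derive_continuous R_AbsRing R_NormedModule).
  now exists v.
- rewrite Rmin_left, Rmax_right in Hc by lra.
  destruct (HF c Hc) as [v [Hv Hd]]. rewrite (is_derive_unique _ _ _ Hd) in HM.
  unfold F in HM. rewrite Cmult_0_l, Cmult_1_l in HM.
  replace ((1 + 0 * rho) / (1 - 0 * rho)) with 1 in HM by field.
  apply Rmult_le_reg_r with (/ (1 - rho)); [apply Rinv_0_lt_compat; lra|].
  rewrite Rmult_assoc, Rinv_r by lra.
  replace (Re (P z) * (1 + rho) * / (1 - rho))
    with (Re (P z) * ((1 + 1 * rho) / (1 - 1 * rho))) by (field; lra).
  lra.
Qed.

(** * Real estimates for [A] beyond [r0] *)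

Lemma A_factor (x : R) : A x = 6 * x * (1 + x) / ((x - 2) * (x ^ 2 + 5 * x - 2)).
Proof. unfold A. f_equal. ring. Qed.

Lemma A_bounds (x : R) : r0 < x -> 3 < x /\ 0 < A x < 1.
Proof.
intros Hx. destruct r0_root_cubic as [Hc [H7 H1]].
assert (H3 : 3 < r0) by nra.
assert (Hden : 0 < (x - 2) * (x ^ 2 + 5 * x - 2)) by (apply Rmult_lt_0_compat; nra).
split; [lra|]. rewrite A_factor. split.
- apply Rdiv_lt_0_compat; [nra|exact Hden].
- apply (Rmult_lt_reg_r _ _ _ Hden).
  unfold Rdiv. rewrite Rmult_assoc, Rinv_l, Rmult_1_r, Rmult_1_l by lra.
  (* Denominator minus numerator of [A] is x^3 - 3 x^2 - 18 x + 4, which vanishes at [r0] and so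
     factors as in [Q]. The second factor is positive because x > r0 > 1 and (r0 - 1)^2 > 7. *)
  assert (Q : 0 < (x - r0) * ((x - 1) ^ 2 + (x - 1) * (r0 - 1) + (r0 - 1) ^ 2 - 21))
    by (apply Rmult_lt_0_compat; nra).
  assert (E : (x - r0) * ((x - 1) ^ 2 + (x - 1) * (r0 - 1) + (r0 - 1) ^ 2 - 21) =
    x ^ 3 - 3 * x ^ 2 - 18 * x - (r0 ^ 3 - 3 * r0 ^ 2 - 18 * r0)) by ring.
  rewrite E in Q. nra.
Qed.

(** The quotient 2 rho / (1 - rho^2) grows with rho, so the extreme case is rho = 1 / (x - 1), that
    is s = 1 after the rescaling s = rho (x - 1). *)
Lemma A_dominates (x rho : R) :
  r0 < x -> 0 <= rho -> rho * (x - 1) <= 1 -> 2 * rho <= A x * (1 - rho ^ 2).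
Proof.
intros Hx H0 H. destruct (A_bounds x Hx) as [H3 _].
assert (Hden : 0 < (x - 2) * (x ^ 2 + 5 * x - 2)) by (apply Rmult_lt_0_compat; nra).
rewrite A_factor.
apply (Rmult_le_reg_r _ _ _ Hden).
replace (6 * x * (1 + x) / ((x - 2) * (x ^ 2 + 5 * x - 2)) * (1 - rho ^ 2) *
  ((x - 2) * (x ^ 2 + 5 * x - 2))) with (6 * x * (1 + x) * (1 - rho ^ 2))
  by (field; nra).
set (s := rho * (x - 1)) in *.
assert (Hs : 0 <= s) by (apply Rmult_le_pos; lra).
apply (Rmult_le_reg_r ((x - 1) ^ 2)); [nra|].
replace (2 * rho * ((x - 2) * (x ^ 2 + 5 * x - 2)) * (x - 1) ^ 2)
  with (s * (2 * (x - 1) * ((x - 2) * (x ^ 2 + 5 * x - 2)))) by (unfold s; ring).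
replace (6 * x * (1 + x) * (1 - rho ^ 2) * (x - 1) ^ 2)
  with (6 * x * (1 + x) * ((x - 1) ^ 2 - s ^ 2)) by (unfold s; ring).
apply Rle_trans with (1 * (2 * (x - 1) * ((x - 2) * (x ^ 2 + 5 * x - 2)))).
- apply Rmult_le_compat_r; nra.
- apply Rle_trans with (6 * x * (1 + x) * ((x - 1) ^ 2 - 1)).
  (* The difference of the two sides at s = 1, with its factor x - 2 taken out. *)
  + assert (0 <= (x - 2) * (4 * x ^ 3 - 2 * x ^ 2 + 14 * x - 4))
      by (apply Rmult_le_pos; [lra|]; assert (0 <= x ^ 2 * (4 * x - 2)) by nra; nra).
    assert (E : (x - 2) * (4 * x ^ 3 - 2 * x ^ 2 + 14 * x - 4) =
      6 * x * (1 + x) * ((x - 1) ^ 2 - 1) -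
      1 * (2 * (x - 1) * ((x - 2) * (x ^ 2 + 5 * x - 2)))) by ring.
    lra.
  + apply Rmult_le_compat_l; nra.
Qed.

(** Here m stands for r Re (p z): the third hypothesis is Harnack's inequality, the fourth follows
    from |z| |1 + r p z| < 1. Eliminating m leaves (1 - rho) (1 - rho (a - 1)) > 0. *)
Lemma disk_image_bound (a rho m : R) :
  2 < a -> 0 <= rho < 1 -> a * (1 - rho) <= m * (1 + rho) -> rho * (1 + m) < 1 ->
  rho * (a - 1) < 1.
Proof.
intros Ha Hrho Hm H.
assert (E : rho * (1 + rho + a * (1 - rho)) < 1 + rho) by nra.
assert (0 < (1 - rho) * (1 - rho * (a - 1))) by nra.
nra.
Qed.

(** With u = U / D, Y is 1 / (1 + u), and |u| <= k is mapped onto the disk with diameter from 1 / (1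
    + k) to 1 / (1 - k). Algebraically, Y - 1 / (1 - k^2) equals - (k^2 D + U) / ((1 - k^2) (D +
    U)). *)
Lemma inverse_disk_bound (Y D U : C) (k : R) :
  0 <= k < 1 -> D <> RtoC 0 -> Cmod U <= k * Cmod D -> (Y * (D + U))%C = D ->
  Cmod (Y - RtoC (1 / (1 - k ^ 2)))%C <= k / (1 - k ^ 2).
Proof.
intros Hk HD HU HY.
assert (Hk2 : 0 < 1 - k ^ 2) by nra.
assert (HT : 0 < Cmod (D + U)).
{ pose proof (Cmod_triangle_rev D (D + U)) as T.
  replace (D + U - D)%C with U in T by ring.
  pose proof (proj1 (Cmod_gt_0 D) HD). nra. }
assert (Hsq : Cmod (RtoC (k ^ 2) * D + U)%C <= Cmod (RtoC k * (D + U))%C).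
{ assert (HU2 : Cmod U ^ 2 <= k ^ 2 * Cmod D ^ 2).
  { rewrite <- Rpow_mult_distr. apply pow_incr. split; [apply Cmod_ge_0|exact HU]. }
  rewrite !Cmod2_alt in HU2. apply Cmod_le_of_sqr.
  destruct D as [a b], U as [c d].
  unfold Re, Im, Cplus, Cmult, RtoC in *. cbn [fst snd] in *.
  (* This product is k^2 |D + U|^2 - |k^2 D + U|^2. *)
  assert (0 <= (1 - k ^ 2) * (k ^ 2 * (a ^ 2 + b ^ 2) - (c ^ 2 + d ^ 2)))
    by (apply Rmult_le_pos; lra).
  lra. }
assert (Hkc : RtoC (1 - k ^ 2) <> RtoC 0) by (intros E; apply RtoC_inj in E; lra).
assert (E : ((Y - RtoC (1 / (1 - k ^ 2))) * (D + U))%C =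
            (- (RtoC (k ^ 2) * D + U) * RtoC (/ (1 - k ^ 2)))%C).
{ unfold Rdiv. rewrite Rmult_1_l, RtoC_inv by lra.
  replace (RtoC (k ^ 2)) with (1 - RtoC (1 - k ^ 2))%C
    by (rewrite RtoC_minus; ring).
  replace ((Y - / RtoC (1 - k ^ 2)) * (D + U))%C
    with (Y * (D + U) - / RtoC (1 - k ^ 2) * (D + U))%C by ring.
  rewrite HY. field. exact Hkc. }
apply (f_equal Cmod) in E.
rewrite !Cmod_mult, Cmod_opp, Cmod_R, Rabs_pos_eq in E
  by (left; apply Rinv_0_lt_compat; lra).
rewrite Cmod_mult, Cmod_R, Rabs_pos_eq in Hsq by lra.
apply (Rmult_le_reg_r _ _ _ HT). rewrite E. unfold Rdiv.
apply (Rmult_le_compat_r (/ (1 - k ^ 2))) in Hsq;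
  [|left; apply Rinv_0_lt_compat; lra].
lra.
Qed.

Theorem theorem3p2 :
  forall (q : C) (r : R) (G : C -> C),
    0 < Re q ->
    0 < r ->
    r0 < r * Re q ->
    resolvents q r G ->
    forall w : C, in_disk w ->
      Cmod (log_derivative G w - RtoC (1 / (1 - A (r * Re q) ^ 2)))%C
        <= A (r * Re q) / (1 - A (r * Re q) ^ 2).
Proof.
intros q r G Hq Hr Hr0 [f [[p [Hp [Hpos [Hp0 Hf]]]] [HG [HGd HGw]]]] w Hw.
unfold in_disk in *.
set (a := r * Re q) in *.
destruct (A_bounds a Hr0) as [Ha HA].
assert (HGp : forall v, Cmod v < 1 -> (G v * (1 + RtoC r * p (G v)))%C = v).
{ intros v Hv. rewrite <- (HGw v Hv) at 3. rewrite (Hf (G v) (HGd v Hv)). ring. }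
assert (Hpd : disk_differentiable p).
{ intros z Hz. exists (C_derive p z). now apply is_Cderive_C_derive, Hp. }
set (z := G w). assert (Hz : Cmod z < 1) by now apply HGd.
destruct (Hpd z Hz) as [l Hl].
set (D := (1 + RtoC r * p z)%C). set (U := (RtoC r * z * l)%C).
assert (HzD : (z * D)%C = w) by now apply HGp.
assert (HReD : Re D = 1 + r * Re (p z)).
{ unfold D, Re, Cplus, Cmult, RtoC. cbn [fst snd]. ring. }
assert (Hrp : 0 <= r * Re (p z)) by (apply Rmult_le_pos; [lra|now apply Hpos]).
assert (HDm : 1 + r * Re (p z) <= Cmod D).
{ rewrite <- HReD. eapply Rle_trans; [apply Rle_abs|apply re_le_Cmod]. }
assert (HD : D <> RtoC 0) by (apply Cmod_gt_0; lra).
pose proof (Cmod_ge_0 z) as Hz0.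
assert (Hrho : Cmod z * (a - 1) < 1).
{ apply (disk_image_bound a (Cmod z) (r * Re (p z))); [lra|lra| |].
  - pose proof (harnack_half_plane p z Hpd Hpos Hz) as Hh. rewrite Hp0 in Hh.
    apply (Rmult_le_compat_l r) in Hh; [|lra]. unfold a. lra.
  - apply Rle_lt_trans with (Cmod w); [|exact Hw].
    rewrite <- HzD, Cmod_mult. now apply Rmult_le_compat_l. }
assert (HU : Cmod U <= A a * Cmod D).
{ pose proof (A_dominates a (Cmod z) Hr0 Hz0 ltac:(lra)) as HAz.
  pose proof (schwarz_pick_half_plane p z l Hpd Hpos Hz Hl) as S.
  assert (Hz2 : 0 < 1 - Cmod z ^ 2) by nra.
  unfold U. rewrite !Cmod_mult, Cmod_R, Rabs_pos_eq by lra.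
  apply (Rmult_le_reg_r _ _ _ Hz2).
  (* Schwarz-Pick first, then r Re (p z) <= |D|, then [A_dominates]. *)
  apply Rle_trans with (r * Cmod z * (2 * Re (p z))).
  - rewrite Rmult_assoc. apply Rmult_le_compat_l; [|exact S].
    apply Rmult_le_pos; lra.
  - apply Rle_trans with (2 * Cmod z * Cmod D); [nra|].
    apply Rle_trans with (A a * (1 - Cmod z ^ 2) * Cmod D); [|lra].
    apply Rmult_le_compat_r; lra. }
assert (HG' : (C_derive G w * (D + U))%C = RtoC 1).
{ pose proof (is_Cderive_C_derive G w (HG w Hw)) as HGw'.
  assert (Hcomp : is_Cderive (fun v => G v * (1 + RtoC r * p (G v)))%C w
    (C_derive G w * (1 + RtoC r * p (G w)) +
     G w * (0 + (0 * p (G w) + RtoC r * (C_derive G w * l))))).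
  { apply (is_Cderive_mult G (fun v => 1 + RtoC r * p (G v))%C); [exact HGw'|].
    apply (is_Cderive_plus (fun _ => RtoC 1) (fun v => RtoC r * p (G v))%C);
      [apply is_Cderive_const|].
    apply (is_Cderive_mult (fun _ => RtoC r) (fun v => p (G v)));
      [apply is_Cderive_const|].
    now apply (is_Cderive_comp p G). }
  (* Near w the function G v (1 + r p (G v)) is the identity, so its derivative, G' w (D + U),
     equals 1. *)
  rewrite (is_Cderive_unique (fun v => v) w 1
    (C_derive G w * (1 + RtoC r * p (G w)) +
     G w * (0 + (0 * p (G w) + RtoC r * (C_derive G w * l))))).
  - unfold D, U, z. ring.
  - apply is_Cderive_id.
  (* The functional equation holds on the unit disk, which contains the ball of radius 1 - |w| about
     w. *)
  - apply (is_Cderive_ext_near _ _ _ _ (1 - Cmod w) ltac:(lra)) with (2 := Hcomp).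
    intros v Hv. apply HGp.
    pose proof (Cmod_triangle (v - w) w) as T.
    replace (v - w + w)%C with v in T by ring. lra. }
apply (inverse_disk_bound _ D U); [lra|exact HD|exact HU|].
unfold log_derivative. fold z. destruct (Ceq_dec w (RtoC 0)) as [E|E].
(* At w = 0, z D = 0 with D nonzero forces z = 0; then U = 0, consistent with the limit value 1. *)
- assert (Hz' : z = RtoC 0).
  { destruct (Ceq_dec z (RtoC 0)) as [E'|E']; [exact E'|].
    exfalso. apply (Cmult_neq_0 z D E' HD). now rewrite HzD. }
  unfold U. rewrite Hz'. ring.
- assert (Hz' : z <> RtoC 0).
  { intros E'. apply E. rewrite <- HzD, E'. ring. }
  replace (w * C_derive G w / z * (D + U))%C
    with (w * (C_derive G w * (D + U)) / z)%C by (field; exact Hz').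
  rewrite HG', <- HzD. field. exact Hz'.
Qed.
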